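(* Every $\mathrm{I}$-favorable space is quasi $\kappa$-metrizable.
   Context: All topological spaces are Tychonoff and non-empty. $\mathrm{I}$-favorable: $X$ is $\mathrm{I}$-favorable if player I has a winning strategy in the open-open game, i.e. there is a function $\sigma$ assigning to every finite (possibly empty) sequence of non-empty open subsets of $X$ a non-empty open subset of $X$, such that for every sequence $(U_k)_{k\ge 0}$ of non-empty open subsets of $X$ with $U_0\subset\sigma(\varnothing)$ and $U_{k+1}\subset\sigma(U_0,\dots,U_k)$ for all $k\ge 0$, the union $\bigcup_{k\ge 0}U_k$ is dense in $X$. Quasi $\kappa$-metric: a set $C\subset X$ is canonically (regularly) closed if it is the closure of its interior. A quasi $\kappa$-metric on $X$ is a non-negative real-valued function $\rho(x,C)$ of two variables, a point $x\in X$ and a canonically closed set $C\subset X$, such that: K1* ) for any $C$ there is a dense open subset $V$ of $X\setminus C$ such that $\rho(x,C)=0$ iff $x\in X\setminus V$; K2) if $C\subset C'$, then $\rho(x,C')\le\rho(x,C)$ for every $x\in X$; K3) $\rho(x,C)$ is a continuous function of $x$ for every $C$; K4) $\rho(x,\overline{\bigcup_\alpha C_\alpha})=\inf_\alpha\rho(x,C_\alpha)$ for every $x \in X$ and every increasing transfinite family $\{C_\alpha\}$ of canonically closed sets in $X$. $X$ is quasi $\kappa$-metrizable if it admits a quasi $\kappa$-metric. *)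

(* Defs.v *)
From mathcomp Require Import all_boot all_order all_algebra.
From mathcomp Require Import all_classical all_reals all_analysis.
From mathcomp Require wochoice.
Set Implicit Arguments.
Unset Strict Implicit.
Unset Printing Implicit Defensive.
Import Order.TTheory GRing.Theory Num.Theory.
Import numFieldNormedType.Exports.
Local Open Scope classical_set_scope.
Local Open Scope ring_scope.

(* By uniform_separatorP, completely_regular_space is separation of points
   from closed sets by continuous functions into [0, 1]. *)
Definition tychonoff_space (X : topologicalType) : Prop :=
  accessible_space X /\ completely_regular_space X.

Definition nonempty_open (X : topologicalType) (U : set X) : Prop :=
  open U /\ U !=set0.

(* The strategy sigma is a total function on lists of sets; only its values on
   lists of non-empty open sets are constrained or used. Since
   mkseq U k = [:: U 0; ...; U k.-1], the condition on U k covers both the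
   opening move (k = 0, empty list) and the later ones. *)
Definition I_favorable (X : topologicalType) : Prop :=
  exists sigma : seq (set X) -> set X,
    (forall s : seq (set X),
       (forall U : set X, U \in s -> nonempty_open U) ->
       nonempty_open (sigma s)) /\
    (forall U : nat -> set X,
       (forall k, nonempty_open (U k)) ->
       (forall k, U k `<=` sigma (mkseq U k)) ->
       dense (\bigcup_k U k)).

(* The second argument of rho ranges over regularly closed sets: the values of
   rho x C for other sets C are irrelevant. *)
Record quasi_kappa_metric (R : realType) (X : topologicalType)
    (rho : X -> set X -> R) : Prop := QuasiKappaMetric {
  qkm_ge0 : forall x C, regclosed C -> 0 <= rho x C ;
  (* ~` C is open, so V is open in ~` C iff it is open in X; V is dense in
     ~` C iff ~` C lies in the closure of V. *)
  qkm_K1 : forall C, regclosed C ->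
    exists V : set X, [/\ open V, V `<=` ~` C, ~` C `<=` closure V &
      forall x, rho x C = 0 <-> (~` V) x] ;
  qkm_K2 : forall C C', regclosed C -> regclosed C' -> C `<=` C' ->
    forall x, rho x C' <= rho x C ;
  qkm_K3 : forall C, regclosed C -> continuous (fun x => rho x C) ;
  (* A transfinite family is indexed by a non-empty well-ordered type. *)
  qkm_K4 : forall (I : Type) (leI : rel I) (C : I -> set X),
    inhabited I -> wochoice.well_order leI ->
    (forall i, regclosed (C i)) ->
    (forall i j, leI i j -> C i `<=` C j) ->
    forall x, rho x (closure (\bigcup_i C i)) =
              inf (range (fun i => rho x (C i)))
}.

Definition quasi_kappa_metrizable (R : realType) (X : topologicalType) : Prop :=
  exists rho : X -> set X -> R, quasi_kappa_metric rho.

(* Main.v *)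
Require Import Defs.
From mathcomp Require Import all_boot all_order all_algebra.
From mathcomp Require Import all_classical all_reals all_analysis.
From mathcomp Require wochoice.
Set Implicit Arguments.
Unset Strict Implicit.
Unset Printing Implicit Defensive.
Import Order.TTheory GRing.Theory Num.Theory.
Import numFieldNormedType.Exports.
Local Open Scope classical_set_scope.
Local Open Scope ring_scope.

(** Say that two continuous real functions touch when they are both positive at
    some point.

    Why favorability helps.  Let a family N of continuous functions be closed
    under minima, finite maxima and a map which turns the winning strategy into
    an operation on functions.  Then N is skeletal: each non-empty open V has a
    W in N such that every member of N touching W meets V.  Otherwise player II
    could answer with members of N and stay off V for ever
    ([favorable_skeletal]).

    The model case. If X is a product of separable metric spaces, one can put
    rho(x, C) := the supremum of the weights of the basic boxes around x which
    miss C, where the weight of a box is small if it restricts many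
    coordinates or if x is close to its boundary. The point is that boxes of
    weight bounded below cannot get lost in a limit: infinitely many of them
    have the same trace r on the coordinates which they share, and as they are
    independent elsewhere, the box r already misses whatever they miss in the
    limit. This yields both upper semicontinuity in x and K4.

    The general case.  X has no coordinates, but the continuous functions on X
    can be arranged in well-founded levels, each of them countable and numbered,
    such that the functions below any given level form a finite union of closed,
    hence skeletal, families ([stratified_setT]; such arrangements are known as
    Davies trees).  Instead of a box take a finite list s of functions, and call
    it good if for every f in s and every g below f some W in s, also below f,
    forces g to touch f as soon as g touches W.  Any function which is positive
    somewhere belongs to a good list with a common point of positivity
    ([good_exists]).  Good lists are independent in the sense required: if f and g
    touch whenever f in s and g in q lie on the same level, then all pairs in
    s and q touch ([good_touch]).  Only pairs of functions are compared,
    never larger subsets, and this is what allows several skeletal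
    families below one level.

    A list misses C when one of its members is positive nowhere on C.
    Limits of good lists are not good in general, so rho is defined with the
    lists obtained from good ones of bounded complexity by dropping functions
    that can be chosen away from any finitely many prescribed levels
    ([approximable]).  This class is stable under limits ([exists_root]), and
    [approximable_limit] is the limit argument of the model case.  It gives
    upper semicontinuity and K4; K2 and lower semicontinuity are immediate from
    the definition of rho, and K1 follows from [good_exists]. *)

(** * Well-orders *)

Lemma wf_minimal (T : Type) (lt : T -> T -> Prop) (P : set T) :
  well_founded lt -> P !=set0 -> exists2 m, P m & forall y, lt y m -> ~ P y.
Proof.
move=> lt_wf [x Px]; apply: contrapT => noM.
elim/(well_founded_ind lt_wf): x Px => x IH Px.
by apply: noM; exists x => // y ltyx Py; exact: (IH _ ltyx Py).
Qed.

Lemma exists_strict_well_order (T : eqType) : exists lt : T -> T -> Prop,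
  [/\ well_founded lt, forall x y z, lt x y -> lt y z -> lt x z &
      forall x y, [\/ lt x y, x = y | lt y x]].
Proof.
have [R Rwo] := wochoice.well_ordering_principle T.
have Rmin (P : set T) : P !=set0 -> exists2 m, P m & forall y, P y -> R m y.
  move=> [x Px]; have [|m [[Pm minm] _]] := Rwo [pred z | `[< P z >]].
    by exists x; apply/asboolP.
  by exists m => [|y Py]; [exact/asboolP|exact/minm/asboolP].
have Rtot x y : R x y || R y x.
  have [|m mxy minm] := Rmin [set z | z = x \/ z = y]; first by exists x; left.
  by case: mxy => me; rewrite me in minm;
    rewrite minm ?orbT //=; [right|left].
have Ranti x y : R x y -> R y x -> x = y.
  move=> Rxy Ryx; have ne : wochoice.nonempty (mem [:: x; y]).
    by exists x; exact: mem_head.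
  have [z [_ zU]] := Rwo _ ne.
  by rewrite -(zU x) ?(zU y) //; split; rewrite ?inE ?eqxx ?orbT // => w;
    rewrite !inE => /orP[] /eqP-> //; have := Rtot x x; have := Rtot y y;
    rewrite !orbb.
exists (fun x y => R x y /\ x <> y); split.
- move=> x; apply: contrapT => Nx.
  have [|m Nm minm] := Rmin [set z | ~ Acc (fun x y => R x y /\ x <> y) z].
    by exists x.
  apply: Nm; split => y [Rym neq]; apply: contrapT => Ny.
  by apply: neq; apply: Ranti => //; exact: minm.
- move=> x y z [Rxy xy] [Ryz yz].
  have [|m mxyz minm] := Rmin [set w | [\/ w = x, w = y | w = z]].
    by exists x; apply: Or31.
  have Rmx : R m x by apply: minm; apply: Or31.
  have Rmy : R m y by apply: minm; apply: Or32.
  have Rmz : R m z by apply: minm; apply: Or33.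
  case: mxyz => me; rewrite {}me in Rmx Rmy Rmz.
  + by split=> // xz; apply: yz; apply: Ranti => //; rewrite -xz.
  + by exfalso; apply: xy; exact: Ranti.
  + by exfalso; apply: yz; exact: Ranti.
- move=> x y; have [->|/eqP xy] := eqVneq x y; first exact: Or32.
  by case/orP: (Rtot x y) => Rxy; [apply: Or31|apply: Or33]; split=> // /esym.
Qed.

(** * Stratifications by finite unions of closed families *)

Section Stratified.
Variables (T : eqType) (op : nat -> seq T -> T).
Implicit Types (N A : set T) (s F : seq T).

Definition opclosed N := forall n s, (forall f, f \in s -> N f) -> N (op n s).

Definition hull A : set T :=
  [set f | forall N, opclosed N -> A `<=` N -> N f].

Lemma sub_hull A : A `<=` hull A.
Proof. by move=> f Af N _; apply. Qed.

Lemma hull_min A N : opclosed N -> A `<=` N -> hull A `<=` N.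
Proof. by move=> clN AN f; apply. Qed.

Lemma opclosed_hull A : opclosed (hull A).
Proof.
move=> n s sA N clN AN; apply: (clN) => f /sA; exact.
Qed.

Lemma hullS A A' : A `<=` A' -> hull A `<=` hull A'.
Proof.
by move=> AA'; apply: hull_min; [exact: opclosed_hull|exact: subset_trans (@sub_hull _)].
Qed.

(** [prec f g] reads: the level of f is below that of g, so that two elements
    are on the same level when [prec] relates them in neither direction.  The
    third clause makes levels countable in the form in which it is used: only
    finitely many elements on the level of g have index at most k.  The fourth
    one writes what is below g as a finite union of closed families. *)
Definition stratification N (prec : T -> T -> Prop) (idx : T -> nat) :=
  [/\ well_founded prec,
      forall f g, prec f g -> N f /\ N g,
      forall g k, N g -> exists E : seq T, forall f, N f -> (idx f <= k)%N ->
        [\/ f \in E, prec f g | prec g f] &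
      forall g, N g -> exists2 Ms : seq (set T),
        forall M, M \in Ms -> opclosed M /\ forall f, M f -> prec f g &
        forall f, prec f g -> exists2 M, M \in Ms & M f].

Definition stratified N := exists prec idx, stratification N prec idx.

(** A countable family can be made into a single level. *)
Lemma stratified_countable N (v : nat -> T) : N `<=` range v -> stratified N.
Proof.
move=> Nv; have {}Nv f : exists n, N f -> v n = f.
  by have [/Nv[n _ <-]|Nf] := pselect (N f); [exists n|exists 0%N].
have [idx idxP] := choice Nv.
exists (fun _ _ => False), idx; split => //.
- move=> g k Ng; exists [seq v i | i <- iota 0 k.+1] => f Nf fk; apply: Or31.
  by rewrite -(idxP _ Nf); apply: map_f; rewrite mem_iota.
- by move=> g _; exists [::].
Qed.

(** The elements generated by F are the values of finite terms, and the terms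
    form a countable type of trees. *)
Lemma hull_finite_countable F : exists v : nat -> T, hull [set` F] `<=` range v.
Proof.
pose d := op 0 [::].
pose ev := fix ev (t : GenTree.tree nat) := match t with
  | GenTree.Leaf i => nth d F i | GenTree.Node n ts => op n (map ev ts) end.
exists (fun n => oapp ev d (unpickle n)).
apply: subset_trans (_ : range ev `<=` _); last first.
  by move=> _ [t _ <-]; exists (pickle t) => //; rewrite pickleK.
apply: hull_min => [n s sev|f fF]; last first.
  by exists (GenTree.Leaf (index f F)) => //=; rewrite nth_index.
suff [ts <-] : exists ts, map ev ts = s by exists (GenTree.Node n ts).
elim: s sev => [|f s IH] sev; first by exists [::].
have [t _ <-] := sev f (mem_head _ _).
have [|ts <-] := IH; last by exists (t :: ts).
by move=> g gs; apply: sev; rewrite inE gs orbT.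
Qed.

Variable lt : T -> T -> Prop.
Hypothesis lt_wf : well_founded lt.
Hypothesis lt_trans : forall x y z, lt x y -> lt y z -> lt x z.
Hypothesis lt_total : forall x y, [\/ lt x y, x = y | lt y x].

Lemma opclosed_chain (J : set T) (N : T -> set T) :
    J !=set0 -> (forall a, J a -> opclosed (N a)) ->
    (forall a b, J a -> J b -> lt a b -> N a `<=` N b) ->
  opclosed (\bigcup_(a in J) N a).
Proof.
move=> [a0 Ja0] clN monoN n s sN.
suff [a Ja sa] : exists2 a, J a & forall f, f \in s -> N a f.
  by exists a => //; exact: clN.
elim: s sN => [|f s IH] sN; first by exists a0.
have [|a Ja sa] := IH; first by move=> g gs; apply: sN; rewrite inE gs orbT.
have [b Jb Nbf] := sN f (mem_head _ _).
case: (lt_total a b) => [ab|ab|ba].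
- by exists b => // g; rewrite inE => /orP[/eqP->//|/sa]; exact: monoN.
- by subst b; exists a => // g; rewrite inE => /orP[/eqP->//|/sa].
- exists a => // g; rewrite inE => /orP[/eqP->|/sa//]; exact: (monoN b a).
Qed.

(** Order the union lexicographically, first by the least a with f in [N a],
    then by the stratification of that [N a].  What is below g is then the union
    of the earlier members of the chain, which is closed as operations are
    finitary, together with the finitely many pieces below g inside [N a]; the
    elements of these pieces which occur earlier in the chain are below g
    anyway.  So passing to the union costs just one more piece. *)
Lemma stratified_chain (J : set T) (N : T -> set T) :
    (forall a, J a -> opclosed (N a)) -> (forall a, J a -> stratified (N a)) ->
    (forall a b, J a -> J b -> lt a b -> N a `<=` N b) ->
  stratified (\bigcup_(a in J) N a).
Proof.
move=> clN strN monoN; set U := \bigcup_(a in J) N a.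
have {}strN a : exists pi : (T -> T -> Prop) * (T -> nat),
    J a -> stratification (N a) pi.1 pi.2.
  have [Ja|Ja] := pselect (J a); last by exists (fun _ _ => False, fun=> 0%N).
  by have [p [i H]] := strN _ Ja; exists (p, i).
have [pi piP] := choice strN.
have first f : exists a, U f -> [/\ J a, N a f & forall b, J b -> N b f -> a = b \/ lt a b].
  have [Uf|] := pselect (U f); last by exists f.
  have [|a [Ja Naf] amin] := @wf_minimal _ lt (fun a => J a /\ N a f) lt_wf.
    by case: Uf => a Ja Naf; exists a.
  exists a => _; split => // b Jb Nbf.
  by case: (lt_total a b) => [|->|/amin[]//]; [right|left].
have [rk rkP] := choice first.
pose prec f g := [/\ U f, U g & lt (rk f) (rk g) \/ rk f = rk g /\ (pi (rk g)).1 f g].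
have precU f g : prec f g -> U f /\ U g by case.
exists prec, (fun f => (pi (rk f)).2 f); split; [|exact: precU| |].
- have accU a : forall f, rk f = a -> U f -> Acc prec f.
    elim/(well_founded_ind lt_wf): a => a IHa f fa Uf.
    have [Ja Naf _] := rkP _ Uf; rewrite fa in Ja Naf.
    have [pwf _ _ _] := piP _ Ja.
    elim/(well_founded_ind pwf): f fa Uf Naf => f IHf fa Uf Naf.
    split=> g [Ug _]; rewrite fa => -[ltg|[ga gf]]; first exact: (IHa _ ltg _ erefl Ug).
    by apply: IHf => //; have [_ + _] := rkP _ Ug; rewrite ga.
  move=> f; have [Uf|nUf] := pselect (U f); first exact: (accU _ _ erefl Uf).
  by split=> g [_ /nUf].
- move=> g k Ug; have [Ja Nag _] := rkP _ Ug.
  have [_ _ fin _] := piP _ Ja; have [E EP] := fin g k Nag.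
  exists E => f Uf; have [_ Naf _] := rkP _ Uf.
  case: (lt_total (rk f) (rk g)) => [fg _|fg|gf _].
  + by apply: Or32; split=> //; left.
  + rewrite fg in Naf * => /(EP _ Naf)[fE|fg'|gf]; first exact: Or31.
    * by apply: Or32; split=> //; right.
    * by apply: Or33; split=> //; right; rewrite fg.
  + by apply: Or33; split=> //; left.
- move=> g Ug; have [Ja Nag amin] := rkP _ Ug; set a := rk g in Ja Nag amin *.
  have [_ pN _ /(_ g Nag)[Ms MsP Mscov]] := piP _ Ja.
  pose L := \bigcup_(b in [set b | J b /\ lt b a]) N b.
  have LU f : L f -> prec f g.
    move=> [b [Jb ba] Nbf]; have Uf : U f by exists b.
    split=> //; left; have [_ _ /(_ b Jb Nbf)[->//|fb]] := rkP _ Uf.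
    exact: (lt_trans fb ba).
  have MsU M f : M \in Ms -> M f -> prec f g.
    move=> /MsP[_ Mp] /Mp fg; have [Naf _] := pN _ _ fg.
    have Uf : U f by exists a.
    split=> //; have [_ _ /(_ a Ja Naf)[fa|fa]] := rkP _ Uf; by [right|left].
  have precL f : prec f g -> L f \/ exists2 M, M \in Ms & M f.
    move=> [Uf _ [fg|[_ /Mscov]]]; last by right.
    by left; exists (rk f); have [Jf Nf _] := rkP _ Uf.
  have [[b [Jb ba]]|noJ] := pselect (exists b, J b /\ lt b a).
  + exists (L :: Ms).
      move=> M; rewrite inE => /orP[/eqP->|MMs]; last first.
        by split=> [|f]; [case: (MsP _ MMs)|exact: MsU].
      split=> //; apply: opclosed_chain; first by exists b.
      * by move=> c [Jc _]; exact: clN.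
      * by move=> c d [Jc _] [Jd _]; exact: monoN.
    move=> f /precL[Lf|[M MMs Mf]]; first by exists L; rewrite ?mem_head.
    by exists M => //; rewrite inE MMs orbT.
  + exists Ms; first by move=> M MMs; split=> [|f]; [case: (MsP _ MMs)|exact: MsU].
    move=> f /precL[[b Jb _]|//]; exfalso; apply: noJ; by exists b.
Qed.

(** The hull of the segment below a and F is the union over b below a of the
    hulls of the segment below b and [b :: F].  Quantifying over F lets the
    induction hypothesis absorb the extra generator b, so that successor and
    limit steps are the same. *)
Lemma stratified_hull_segment a : forall F,
  stratified (hull ([set b | lt b a] `|` [set` F])).
Proof.
elim/(well_founded_ind lt_wf): a => a IH F.
have [[b0 b0a]|noB] := pselect (exists b, lt b a); last first.
  have [v Fv] := hull_finite_countable F.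
  apply: (stratified_countable (v := v)); apply: subset_trans Fv; apply: hullS.
  by move=> f [fa|//]; exfalso; apply: noB; exists f.
pose N b := hull ([set c | lt c b] `|` [set` b :: F]).
have monoN b c : lt b a -> lt c a -> lt b c -> N b `<=` N c.
  move=> _ _ bc; apply: hullS => f [/= fb|/=]; first by left; exact: lt_trans bc.
  rewrite inE => /orP[/eqP->|fF]; first by left.
  by right; rewrite /= inE fF orbT.
have -> : hull ([set b | lt b a] `|` [set` F]) = \bigcup_(b in [set b | lt b a]) N b.
  apply/seteqP; split.
    apply: hull_min => [|f [fa|fF]].
    - apply: opclosed_chain => [||]; first by exists b0.
      + by move=> b _; exact: opclosed_hull.
      + exact: monoN.
    - by exists f => //; apply: sub_hull; right; exact: mem_head.
    - by exists b0 => //; apply: sub_hull; right; rewrite /= inE fF orbT.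
  move=> f [b /= ba]; apply: hullS => c [/= cb|/=]; first by left; exact: lt_trans ba.
  by rewrite inE => /orP[/eqP->|cF]; [left|right].
apply: stratified_chain => [b _|b ba|]; [exact: opclosed_hull|exact: IH|exact: monoN].
Qed.

Lemma stratified_setT_of_order : stratified setT.
Proof.
pose N b := hull ([set c | lt c b] `|` [set` [:: b]]).
have -> : setT = \bigcup_(b in setT) N b.
  apply/seteqP; split=> // f _; exists f => //; apply: sub_hull; right.
  exact: mem_head.
apply: stratified_chain => [b _|b _|b c _ _ bc].
- exact: opclosed_hull.
- exact: stratified_hull_segment.
- apply: hullS => f [/= fb|/=]; first by left; exact: lt_trans bc.
  by rewrite inE => /eqP->; left.
Qed.

End Stratified.

Theorem stratified_setT (T : eqType) (op : nat -> seq T -> T) :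
  stratified op setT.
Proof.
have [lt [wf tr tot]] := exists_strict_well_order T.
exact: stratified_setT_of_order wf tr tot.
Qed.

(** * Skeletal families of continuous functions *)

Section Cozero.
Variables (R : realType) (X : topologicalType).
Local Notation T := (continuousType X R).
Implicit Types (f g h : T) (s q r : seq T) (U V C : set X) (N : set T).

Definition coz f : set X := [set x | 0 < f x].

Definition touch f g := coz f `&` coz g !=set0.

Lemma touchC f g : touch f g -> touch g f.
Proof. by rewrite /touch setIC. Qed.

Lemma open_coz f : open (coz f).
Proof.
apply: (@open_comp _ _ (f : X -> R) [set y | 0 < y]); last exact: open_gt.
by move=> x _; exact: cts_fun.
Qed.

Lemma continuous_minf f g : continuous ((f : X -> R) \min (g : X -> R)).
Proof. by move=> x; apply: continuous_min; exact: cts_fun. Qed.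

Lemma continuous_maxf f g : continuous ((f : X -> R) \max (g : X -> R)).
Proof. by move=> x; apply: continuous_max; exact: cts_fun. Qed.

Definition minf f g : T := mkcts (@continuous_minf f g).
Definition maxf f g : T := mkcts (@continuous_maxf f g).
Definition zerof : T := mkcts (@cst_continuous X R 0).
Definition maxs s : T := foldr maxf zerof s.

Lemma coz_minf f g : coz (minf f g) = coz f `&` coz g.
Proof.
by apply/seteqP; split=> x; rewrite /coz /= lt_min => /andP.
Qed.

Lemma coz_maxf f g : coz (maxf f g) = coz f `|` coz g.
Proof.
by apply/seteqP; split=> x; rewrite /coz /= lt_max => /orP.
Qed.

Lemma coz_maxs s x : coz (maxs s) x <-> exists2 f, f \in s & coz f x.
Proof.
elim: s => [|f s IH] /=; first by split=> [|[]//]; rewrite /coz /= ltxx.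
rewrite coz_maxf; split=> [[fx|/IH[g gs gx]]|[g]].
- by exists f; rewrite ?mem_head.
- by exists g; rewrite // inE gs orbT.
- by rewrite inE => /orP[/eqP->|gs gx]; [left|right; apply/IH; exists g].
Qed.

Lemma coz_basis U x : completely_regular_space X -> open U -> U x ->
  exists2 f, coz f x & coz f `<=` U.
Proof.
move=> crX oU Ux.
have /(@uniform_separatorP _ R)[f [fc _ f0 f1]] : uniform_separator [set x] (~` U).
  by apply: crX; [exact: open_closedC|exact].
have gc : continuous (fun y => 1 - f y).
  by move=> y; apply: cvgB; [exact: cvg_cst|exact: fc].
exists (mkcts gc) => [|y]; rewrite /coz /=.
  have fx0 : f x = 0 by apply: f0; exists x.
  by change (0 < 1 - f x); rewrite fx0 subr0 ltr01.
change (0 < 1 - f y -> U y) => fy; apply: contrapT => nUy.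
have fy1 : f y = 1 by apply: f1; exists y.
by rewrite fy1 subrr ltxx in fy.
Qed.

(** W stands for the projection of the open sets of Vs to N: members of N cannot
    avoid the union of Vs near W.  Finitely many open sets are treated together
    so that a single W meets all of them. *)
Definition skeletal N := forall Vs : seq (set X),
  (forall V, V \in Vs -> nonempty_open V) ->
  exists W, [/\ N W, forall V, V \in Vs -> coz W `&` V !=set0 &
    forall g, N g -> touch g W -> exists2 V, V \in Vs & coz g `&` V !=set0].

(** The operations are the minimum of two functions, the maximum of a list, and a
    map [tau] which replaces the answer of the strategy to the cozero sets of a
    list by a function which is positive somewhere, and only inside that answer. *)
Lemma favorable_skeletal : completely_regular_space X -> I_favorable X ->
  exists op : nat -> seq T -> T, forall N, opclosed op N -> skeletal N.
Proof.
move=> crX [sigma [sigma_open sigma_win]].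
have tau_ex s : exists t, (forall f, f \in s -> coz f !=set0) ->
    coz t !=set0 /\ coz t `<=` sigma (map coz s).
  have [sne|sne] := pselect (forall f, f \in s -> coz f !=set0); last by exists zerof.
  have [U /mapP[f fs ->]|oS [x Sx]] := sigma_open (map coz s).
    by split; [exact: open_coz|exact: sne].
  have [t tx tS] := coz_basis crX oS Sx.
  by exists t => _; split => //; exists x.
have [tau tauP] := choice tau_ex.
pose op n s := match n with
  | 0 => minf (nth zerof s 0) (nth zerof s 1) | 1 => maxs s | _ => tau s end.
exists op => N clN.
have Nmin f g : N f -> N g -> N (minf f g).
  move=> Nf Ng; apply: (clN 0 [:: f; g]) => h.
  by rewrite !inE => /orP[] /eqP->.
have Nmax s : (forall f, f \in s -> N f) -> N (maxs s) by exact: clN 1 s.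
have Ntau s : (forall f, f \in s -> N f) -> N (tau s) by exact: clN 2 s.
have single V : nonempty_open V -> exists W, [/\ N W, coz W `&` V !=set0 &
    forall g, N g -> touch g W -> coz g `&` V !=set0].
  move=> [oV [v Vv]].
  suff [W [NW W0 WV]] : exists W, [/\ N W, coz W !=set0 & forall g, N g ->
      coz g !=set0 -> coz g `<=` coz W -> coz g `&` V !=set0].
    exists W; split => //; first exact: WV.
    move=> g Ng gW; have [|||x] := WV (minf g W).
    - exact: Nmin.
    - by rewrite coz_minf.
    - by rewrite coz_minf; exact: subIsetr.
    - by rewrite coz_minf => -[[gx _] Vx]; exists x.
  (* If every non-zero W in N had a refinement [G W] in N off V, player II would
     answer the moves [tau] of player I by [G], and V would not meet the union. *)
  apply: contrapT => noW.
  have G_ex W : exists g, N W -> coz W !=set0 ->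
      [/\ N g, coz g !=set0, coz g `<=` coz W & ~ (coz g `&` V !=set0)].
    apply: contrapT => noG; apply: noW; exists W.
    have [NW|NW] := pselect (N W); last by exfalso; apply: noG; exists W => /NW.
    have [W0|W0] := pselect (coz W !=set0); last by exfalso; apply: noG; exists W => _ /W0.
    split => // g Ng g0 gW; apply: contrapT => gV.
    by apply: noG; exists g.
  have [G GP] := choice G_ex.
  pose L := fix L k := if k is k'.+1 then rcons (L k') (G (tau (L k'))) else [::].
  pose u k := G (tau (L k)).
  have Lu k : L k = mkseq u k by elim: k => // k IH; rewrite mkseqS -IH.
  have uP k : [/\ N (u k), coz (u k) !=set0, coz (u k) `<=` coz (tau (L k)) &
      ~ (coz (u k) `&` V !=set0)].
    elim/ltn_ind: k => k IH.
    have LP f : f \in L k -> N f /\ coz f !=set0.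
      by rewrite Lu => /mapP[i]; rewrite mem_iota => /andP[_ ik] ->; case: (IH i ik).
    apply: GP; first by apply: Ntau => f /LP[].
    by have [] := tauP (L k) (fun f fL => (LP f fL).2).
  have : dense (\bigcup_k coz (u k)).
    apply: sigma_win => k; first by split; [exact: open_coz|case: (uP k)].
    have [_ _ sub _] := uP k; apply: subset_trans sub _.
    have -> : mkseq (fun k => coz (u k)) k = map coz (L k).
      by rewrite Lu /mkseq -map_comp.
    by apply: (tauP _ _).2 => f; rewrite Lu => /mapP[i _ ->]; case: (uP i).
  have V0 : V !=set0 by exists v.
  move=> /(_ V V0 oV)[x [Vx [k _ ukx]]].
  by have [_ _ _] := uP k; apply; exists x.
(* The maximum of witnesses for single sets is a witness for the list. *)
elim=> [|V Vs IH] VsP.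
  exists (maxs [::]); split=> //; first exact: Nmax.
  by move=> g _ [x [_]] /coz_maxs[].
have [|W1 [NW1 W1Vs gW1]] := IH.
  by move=> U UVs; apply: VsP; rewrite inE UVs orbT.
have [W0 [NW0 W0V gW0]] := single V (VsP V (mem_head _ _)).
exists (maxs [:: W0; W1]); split.
- by apply: Nmax => f; rewrite !inE => /orP[] /eqP->.
- move=> U; rewrite inE => /orP[/eqP->|/W1Vs [x [W1x Ux]]].
    case: W0V => x [W0x Vx]; exists x; split=> //.
    by apply/coz_maxs; exists W0; rewrite ?mem_head.
  by exists x; split=> //; apply/coz_maxs; exists W1; rewrite // !inE eqxx orbT.
- move=> g Ng [x [gx]] /coz_maxs[W]; rewrite !inE => /orP[] /eqP-> Wx.
    by exists V; rewrite ?mem_head //; apply: gW0 => //; exists x.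
  have [|U UVs gU] := gW1 g Ng; first by exists x.
  by exists U; rewrite // inE UVs orbT.
Qed.

End Cozero.

(** * Good lists *)

Section KappaMetric.
Variables (R : realType) (X : topologicalType).
Local Notation T := (continuousType X R).
Implicit Types (f g h : T) (s q r F : seq T) (U V C : set X).

Variables (prec : T -> T -> Prop) (idx : T -> nat).
Hypothesis prec_wf : well_founded prec.
Hypothesis prec_fin : forall g k, exists E : seq T, forall f, (idx f <= k)%N ->
  [\/ f \in E, prec f g | prec g f].
Hypothesis prec_pieces : forall g, exists2 Ms : seq (set T),
  forall M, M \in Ms -> skeletal M /\ forall f, M f -> prec f g &
  forall f, prec f g -> exists2 M, M \in Ms & M f.
Hypothesis crX : completely_regular_space X.

Definition comparable f g := prec f g \/ prec g f.

(** In a product, the part of a box on earlier coordinates determines which sets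
    depending on earlier coordinates it meets.  Here the finitely many W below f
    take over that role: they control which g below f touch f. *)
Definition good s := forall f, f \in s -> forall g, prec g f ->
  exists W, [/\ W \in s, prec W f & touch g W -> touch g f].

Definition cap s : set X := [set x | forall f, f \in s -> coz f x].

Lemma open_cap s : open (cap s).
Proof.
elim: s => [|f s IH].
  suff -> : cap [::] = setT by exact: openT.
  by apply/seteqP; split.
suff -> : cap (f :: s) = coz f `&` cap s by apply: openI => //; exact: open_coz.
apply/seteqP; split=> x.
  by move=> fsx; split=> [|g gs]; apply: fsx; rewrite ?mem_head // inE gs orbT.
by move=> [fx sx] g; rewrite inE => /orP[/eqP->|/sx].
Qed.

(** Well-founded descent on the pair (f, g): if f and g are on different levels,
    goodness of the list that contains the higher one replaces it by a lower
    member of the same list.  The descent ends at a pair on the same level. *)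
Lemma good_touch s q : good s -> good q ->
    (forall f g, f \in s -> g \in q -> comparable f g \/ touch f g) ->
  forall f g, f \in s -> g \in q -> touch f g.
Proof.
move=> gs gq sq f; elim/(well_founded_ind prec_wf): f => f IHf g.
elim/(well_founded_ind prec_wf): g => g IHg fs gq'.
have [[fg|gf]|//] := sq f g fs gq'.
- have [W [Wq Wg]] := gq g gq' f fg; apply; exact: IHg.
- have [W [Ws Wf]] := gs f fs g gf => H; apply/touchC/H/touchC; exact: IHf.
Qed.

(** Add to f one projection W into each of the pieces below f, then what each of
    these W needs in turn; levels are well-founded, so this ends.  The open sets
    are shrunk along the way to remain inside all functions added so far.  With
    one open set this gives a common point of positivity; with several, a list
    whose members all meet several prescribed sets. *)
Lemma good_exists f (Vs : seq (set X)) :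
    (forall V, V \in Vs -> nonempty_open V /\ V `<=` coz f) ->
  exists s, [/\ good s, f \in s & forall V, V \in Vs -> V `&` cap s !=set0].
Proof.
elim/(well_founded_ind prec_wf): f Vs => f IH Vs VsP.
have [Ms MsP Mscov] := prec_pieces f.
suff [s [gs sMs sVs]] : exists s, [/\ good s,
    forall M, M \in Ms -> exists W, [/\ W \in s, M W &
      forall g, M g -> touch g W -> touch g f] &
    forall V, V \in Vs -> V `&` cap s !=set0].
  exists (f :: s); split; first last.
  - move=> V VVs; have [x [Vx sx]] := sVs V VVs; exists x; split => // g.
    by rewrite inE => /orP[/eqP->|/sx//]; exact: (VsP V VVs).2.
  - exact: mem_head.
  - move=> g; rewrite inE => /orP[/eqP->|gin] h hg.
      have [M MMs Mh] := Mscov _ hg; have [W [Ws MW Wf]] := sMs _ MMs.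
      exists W; split; [by rewrite inE Ws orbT|exact: (MsP _ MMs).2|exact: Wf].
    by have [W [Ws Wg H]] := gs g gin h hg; exists W; rewrite inE Ws orbT.
clear Mscov; elim: Ms Vs VsP MsP => [|M Ms IHMs] Vs VsP MsP.
  by exists [::]; split=> // V /VsP[[_ [x Vx]] _]; exists x.
have [Msk Mf] := MsP M (mem_head _ _).
have [|W [MW WVs Wg]] := Msk Vs; first by move=> V /VsP[].
have [|s1 [gs1 Ws1 s1Vs]] := IH W (Mf _ MW) [seq V `&` coz W | V <- Vs].
  move=> _ /mapP[V VVs ->]; split; last exact: subIsetr.
  split; last by have [x [? ?]] := WVs V VVs; exists x.
  by apply: openI; [case: (VsP _ VVs) => -[]|exact: open_coz].
have [||s2 [gs2 s2Ms s2Vs]] := IHMs [seq V `&` cap s1 | V <- Vs].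
- move=> _ /mapP[V VVs ->]; have [[oV _] Vf] := VsP _ VVs; split; last first.
    by move=> x [/Vf].
  split; first by apply: openI => //; exact: open_cap.
  have [x [[Vx _] s1x]] := s1Vs _ (map_f _ VVs); by exists x.
- by move=> N NMs; apply: MsP; rewrite inE NMs orbT.
exists (s1 ++ s2); split.
- move=> g; rewrite mem_cat => /orP[gs|gs] h hg.
    by have [W' [W's ? ?]] := gs1 g gs h hg; exists W'; rewrite mem_cat W's.
  by have [W' [W's ? ?]] := gs2 g gs h hg; exists W'; rewrite mem_cat W's orbT.
- move=> N; rewrite inE => /orP[/eqP->|NMs].
    exists W; split=> //; first by rewrite mem_cat Ws1.
    move=> g Mg /(Wg g Mg)[V VVs [x [gx Vx]]]; exists x; split=> //.
    exact: (VsP V VVs).2.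
  by have [W' [W's ? ?]] := s2Ms N NMs; exists W'; rewrite mem_cat W's orbT.
- move=> V VVs; have [x [[Vx s1x] s2x]] := s2Vs _ (map_f _ VVs).
  by exists x; split=> // g; rewrite mem_cat => /orP[/s1x|/s2x].
Qed.

(** * Limits of good lists of bounded complexity *)

Definition bounded k s := (size s <= k)%N /\ forall f, f \in s -> (idx f <= k)%N.

(** A substitute for being good that passes to limits: r can be completed to a
    good list of complexity at most k by functions off the levels of any given
    finite F.  Hence if F is good and r touches all of F, then by [good_touch]
    such a completion touches all of F. *)
Definition approximable k r := forall F, exists s, [/\ good s, bounded k s, {subset r <= s} &
  forall f g, f \in s -> f \notin r -> g \in F -> comparable f g].

Lemma good_approximable k s : good s -> bounded k s -> approximable k s.
Proof. by move=> gs bs F; exists s; split=> // f g ->. Qed.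

Lemma approximableS k k' r : (k <= k')%N -> approximable k r -> approximable k' r.
Proof.
move=> kk' ar F; have [s [gs [sz ix] rs sF]] := ar F; exists s; split=> //.
by split=> [|f /ix]; [exact: leq_trans kk'|move=> /leq_trans; exact].
Qed.

Lemma incomparable_finite k F : exists E : seq T, forall f, (idx f <= k)%N ->
  f \in E \/ forall g, g \in F -> comparable f g.
Proof.
elim: F => [|g F [E EP]]; first by exists [::] => f _; right.
have [E' E'P] := prec_fin g k; exists (E' ++ E) => f fk; rewrite mem_cat.
have [->|EF] := EP f fk; first by rewrite orbT; left.
have [->||] := E'P f fk; first by left.
- by move=> fg; right => h; rewrite inE => /orP[/eqP->|/EF//]; left.
- by move=> fg; right => h; rewrite inE => /orP[/eqP->|/EF//]; right.
Qed.

(** The root of the sequence is a list r of the largest possible size that is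
    contained in infinitely many [u n].  By maximality any other function belongs
    to finitely many of these [u n].  As only finitely many functions of index at
    most k share a level with a member of F, those outside r are avoided
    eventually. *)
Lemma exists_root k (u : nat -> seq T) : (forall n, approximable k (u n)) ->
  exists2 r, approximable k r & forall F m, exists n, [/\ (m <= n)%N, {subset r <= u n} &
    forall f g, f \in u n -> f \notin r -> g \in F -> comparable f g].
Proof.
move=> ua.
have ub n : exists2 s, bounded k s & {subset u n <= s}.
  by have [s [_ bs us _]] := ua n [::]; exists s.
pose often r := forall m, exists2 n, (m <= n)%N & {subset r <= u n}.
pose P j := `[< exists r, [/\ uniq r, size r = j & often r] >].
have P0 : exists j, P j.
  by exists 0%N; apply/asboolP; exists [::]; split=> // m; exists m.
have Pk j : P j -> (j <= k)%N.
  move=> /asboolP[r [ur <- oft]]; have [n _ run] := oft 0%N.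
  have [s [sk _] us] := ub n; apply: leq_trans sk.
  by apply: uniq_leq_size => // f /run /us.
have [j /asboolP[r [ur rj oftr]] maxj] := ex_maxnP P0 Pk.
have rare f : f \notin r -> exists m, forall n, (m <= n)%N ->
    {subset r <= u n} -> f \notin u n.
  move=> fr; apply: contrapT => norare.
  suff /maxj : P j.+1 by rewrite ltnn.
  apply/asboolP; exists (f :: r); split; rewrite /= ?fr ?rj // => m.
  apply: contrapT => no; apply: norare; exists m => n mn run.
  apply/negP => fu; apply: no; exists n => // g.
  by rewrite inE => /orP[/eqP->|/run].
have rootP F m : exists n, [/\ (m <= n)%N, {subset r <= u n} &
    forall f g, f \in u n -> f \notin r -> g \in F -> comparable f g].
  have [E EP] := incomparable_finite k F.
  have [m' m'P] : exists m', forall f, f \in E -> f \notin r -> forall n, (m' <= n)%N ->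
      {subset r <= u n} -> f \notin u n.
    elim: E {EP} => [|f E [m1 m1P]]; first by exists 0%N.
    have [fr|fr] := boolP (f \in r).
      by exists m1 => g; rewrite inE => /orP[/eqP->|/m1P//]; rewrite fr.
    have [m2 m2P] := rare f fr; exists (maxn m1 m2) => g gfE gr n; rewrite geq_max.
    move=> /andP[m1n m2n]; move: gfE; rewrite inE => /orP[/eqP->|gE]; first exact: m2P.
    exact: m1P.
  have [n mn run] := oftr (maxn m m'); move: mn; rewrite geq_max => /andP[mn m'n].
  exists n; split=> // f g fu fr gF; have [s [_ sk] us] := ub n.
  have [fE|] := EP f (sk _ (us _ fu)); last exact.
  by have := m'P f fE fr n m'n run; rewrite fu.
exists r => // F; have [n [_ run unF]] := rootP F 0%N.
have [s [gs bs us sF]] := ua n F; exists s; split=> //.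
  by move=> f /run /us.
move=> f g fs fr gF; have [fu|fu] := boolP (f \in u n); first exact: unF.
exact: sF.
Qed.

Definition meets f C := coz f `&` C !=set0.

Definition misses r C := exists2 h, h \in r & ~ meets h C.

Lemma meets_interior f C : regclosed C -> meets f C -> meets f C°.
Proof.
move=> rC [x [fx Cx]]; have : closure C° x by rewrite rC.
move=> /(_ (coz f)); rewrite /meets setIC; apply.
by apply: open_nbhs_nbhs; split=> //; exact: open_coz.
Qed.

Lemma bump_meeting r U : open U -> (forall h, h \in r -> meets h U) ->
  exists2 g, coz g `<=` U & forall h, h \in r -> touch g h.
Proof.
move=> oU; elim: r => [|h r IH] rU.
  by exists (maxs [::]) => // x /coz_maxs[].
have [|g gU gr] := IH; first by move=> h' h'r; apply: rU; rewrite inE h'r orbT.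
have [x [hx Ux]] := rU h (mem_head _ _).
have [f fx fU] := coz_basis R crX oU Ux.
exists (maxf f g); first by rewrite coz_maxf subUset.
move=> h'; rewrite inE /touch coz_maxf => /orP[/eqP->|/gr[z [gz h'z]]].
  by exists x; split=> //; left.
by exists z; split=> //; right.
Qed.

Lemma chain_catch (I : Type) (D : I -> set X) :
    (forall i j, D i `<=` D j \/ D j `<=` D i) ->
  forall i (L : seq T), exists2 m, D i `<=` D m &
    forall h, h \in L -> meets h (\bigcup_i D i) -> meets h (D m).
Proof.
move=> chain i; elim=> [|h L [m im mL]]; first by exists i.
have [[x [hx [j _ Djx]]]|no] := pselect (meets h (\bigcup_i D i)); last first.
  by exists m => // h'; rewrite inE => /orP[/eqP->|/mL].
have [mj|jm] := chain m j.
  exists j; first exact: subset_trans mj.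
  move=> h'; rewrite inE => /orP[/eqP-> _|h'L /(mL _ h'L)[z [h'z /mj Djz]]].
    by exists x.
  by exists z.
exists m => // h'; rewrite inE => /orP[/eqP-> _|/mL//].
by exists x; split=> //; exact: jm.
Qed.

(** The lists of the hypothesis may be taken far out in the chain D and at points y
    where the previously chosen functions are hardly larger than at x.  Choose in
    this way a sequence, and let r be its root.  The members of r occur again
    and again in the sequence, hence are at least c - d at x.  If all members of r
    met the union of D, a good list q containing a function g positive only inside
    some member of the chain could be chosen to touch r; then by independence a
    late list of the sequence would touch q, although it misses a set of the
    chain that contains the cozero set of g. *)
Lemma approximable_limit (I : Type) (i0 : I) (D : I -> set X) (x : X) (c d : R) (k : nat) :
    (forall i, regclosed (D i)) -> (forall i j, D i `<=` D j \/ D j `<=` D i) ->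
    (forall (L : seq T) i, exists j y r, [/\ D i `<=` D j,
      forall h, h \in L -> h y <= h x + d, approximable k r, misses r (D j) &
      forall h, h \in r -> c <= h y]) ->
  exists r, [/\ approximable k r, misses r (\bigcup_i D i) & forall h, h \in r -> c - d <= h x].
Proof.
move=> rD chain H.
have H' (st : seq T * I) : exists p : I * X * seq T, [/\ D st.2 `<=` D p.1.1,
      forall h, h \in st.1 -> h p.1.2 <= h x + d, approximable k p.2, misses p.2 (D p.1.1) &
      forall h, h \in p.2 -> c <= h p.1.2].
  by have [j [y [r P]]] := H st.1 st.2; exists (j, y, r).
have [p pP] := choice H'.
have M_ex (st : I * seq T) : exists m, D st.1 `<=` D m /\
    forall h, h \in st.2 -> meets h (\bigcup_i D i) -> meets h (D m).
  by have [m ? ?] := chain_catch chain st.1 st.2; exists m.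
have [M MP] := choice M_ex.
pose st := fix st n : seq T * I := if n is n'.+1 then
  let L := (st n').1 ++ (p (st n')).2 in (L, M ((p (st n')).1.1, L)) else ([::], i0).
pose u n := (p (st n)).2; pose y n := (p (st n)).1.2; pose j n := (p (st n)).1.1.
have uL m n : (m < n)%N -> {subset u m <= (st n).1}.
  elim: n => // n IH; rewrite ltnS leq_eqVlt => /orP[/eqP->|/IH mn] f fu /=.
    by rewrite mem_cat fu orbT.
  by rewrite mem_cat (mn _ fu).
have Dst n : D (j n) `<=` D (st n.+1).2 by case: (MP (j n, (st n.+1).1)).
have Dj n : D (st n).2 `<=` D (j n) by case: (pP (st n)).
have Dmon m n : (m <= n)%N -> D (j m) `<=` D (j n).
  elim: n => [|n IH]; first by rewrite leqn0 => /eqP->.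
  rewrite leq_eqVlt => /orP[/eqP->//|/IH mn].
  by apply: subset_trans mn _; apply: subset_trans (Dst n) (Dj n.+1).
have catch n h : h \in (st n.+1).1 -> meets h (\bigcup_i D i) -> meets h (D (st n.+1).2).
  by case: (MP (j n, (st n.+1).1)) => _ /(_ h).
have ua n : approximable k (u n) by case: (pP (st n)).
have [r ra root] := exists_root ua.
exists r; split=> //.
- apply: contrapT => nomiss.
  have rmeets h : h \in r -> meets h (\bigcup_i D i).
    by move=> hr; apply: contrapT => nh; apply: nomiss; exists h.
  have [n0 [_ run0 _]] := root [::] 0%N.
  (* All members of r occur in [u n0], hence each of them meets the set of the
     chain chosen just after stage n0, and meets its interior. *)
  pose U := (D (st n0.+1).2)°.
  have [||g gU gr] := @bump_meeting r U.
  + exact: open_interior.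
  + move=> h hr; apply: meets_interior => //; apply: catch; last exact: rmeets.
    by apply: uL (ltnSn n0) _ _; exact: run0.
  have [|q [gq gin qr]] := @good_exists g [seq coz g `&` coz h | h <- r].
    move=> _ /mapP[h hr ->]; split; last exact: subIsetl.
    by split; [apply: openI; exact: open_coz|exact: gr].
  (* Complete a late [u n] to a good list s whose members outside r are on other
     levels than those of q; the members of r touch q by the choice of q. *)
  have [n [n0n run unq]] := root q n0.+1.
  have [s [gs _ us sq]] := ua n q.
  have [_ _ _ [h hu hmiss] _] := pP (st n).
  have [z [hz gz]] : touch h g.
    apply: (good_touch gs gq) gin => [f f' fs f'q|]; last exact: us.
    have [fr|fr] := boolP (f \in r).
      right; have [z [[_ fz] qz]] := qr _ (map_f _ fr).
      by exists z; split=> //; exact: qz.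
    left; have [fu|fu] := boolP (f \in u n); first exact: unq.
    exact: sq.
  apply: hmiss; exists z; split=> //; apply: (Dmon n0.+1 n n0n); apply: Dj.
  by apply: interior_subset; exact: gU.
- move=> h hr; have [n0 [_ run0 _]] := root [::] 0%N.
  (* When [y n1] was chosen, the members of r had occurred in [u n0], so their
     values at x are at least those at [y n1] up to d. *)
  have [n1 [n01 run1 _]] := root [::] n0.+1.
  have [_ /(_ h) yL _ _ /(_ h) cy] := pP (st n1).
  rewrite lerBlDr; apply: le_trans (cy _) (yL _); first exact: run1.
  by apply: uL n01 _ _; exact: run0.
Qed.

Implicit Types (x y : X) (e v : R).

(** * The quasi kappa-metric *)

(** The number v bounds the values of the functions from below and their complexity,
    through the integral part of the inverse of v, from above. *)
Definition far x C v := exists r,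
  [/\ approximable (Num.truncn v^-1) r, misses r C & forall h, h \in r -> v <= h x].

Definition rho x C := sup [set v | v = 0 \/ [/\ 0 < v, v <= 1 & far x C v]].

Lemma truncn_inv_le v v' : 0 < v' -> v' <= v ->
  (Num.truncn v^-1 <= Num.truncn v'^-1)%N.
Proof.
by move=> v'0 v'v; apply: le_truncn; rewrite lef_pV2 // posrE (lt_le_trans v'0).
Qed.

Lemma far_le x C v v' : 0 < v' -> v' <= v -> far x C v -> far x C v'.
Proof.
move=> v'0 v'v [r [ar mr vr]]; exists r; split=> //.
  exact: approximableS (truncn_inv_le v'0 v'v) ar.
by move=> h /vr; exact: le_trans.
Qed.

Lemma far_sub x C C' v : C `<=` C' -> far x C' v -> far x C v.
Proof.
move=> CC' [r [ar [h hr hC'] vr]]; exists r; split=> //; exists h => //.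
by move=> [z [hz Cz]]; apply: hC'; exists z; split=> //; exact: CC'.
Qed.

Let rho_has_ub x C : has_ubound [set v | v = 0 \/ [/\ 0 < v, v <= 1 & far x C v]].
Proof. by exists 1 => v [->|[]]. Qed.

Lemma rho_ge0 x C : 0 <= rho x C.
Proof. by apply: ub_le_sup => //; left. Qed.

Lemma rho_le1 x C : rho x C <= 1.
Proof. by apply: ge_sup => [|v [->|[]]//]; exists 0; left. Qed.

Lemma rho_ge x C v : 0 < v -> v <= 1 -> far x C v -> v <= rho x C.
Proof. by move=> v0 v1 xv; apply: ub_le_sup => //; right. Qed.

Lemma rho_gt x C v : 0 < v -> v < rho x C -> v <= 1 /\ far x C v.
Proof.
move=> v0 vrho; split; first exact: le_trans (ltW vrho) (rho_le1 _ _).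
have [|w] := sup_gt _ vrho; first by exists 0; left.
move=> [->|[w0 _ xw] vw]; first by rewrite ltNge ltW.
exact: far_le (ltW vw) xw.
Qed.

Lemma rho_le_sub x C C' : C `<=` C' -> rho x C' <= rho x C.
Proof.
move=> CC'; apply: ge_sup => [|v [->|[v0 v1 xv]]]; first by exists 0; left.
  exact: rho_ge0.
by apply: rho_ge => //; exact: far_sub xv.
Qed.

Lemma near_seq_lt r x (a : T -> R) : (forall h, h \in r -> a h < h x) ->
  \forall y \near x, forall h, h \in r -> a h < h y.
Proof.
elim: r => [|h r IH] ax; first by apply: nearW.
have hx : \forall y \near x, a h < h y.
  apply: (@cts_fun _ _ h x [set z | a h < z]); apply: open_nbhs_nbhs.
  by split; [exact: open_gt|exact: ax (mem_head _ _)].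
have {IH}rx := IH (fun h' h'r => ax h' (mem_behead (s := h :: r) h'r)).
by apply: filterS2 hx rx => y hy ry h'; rewrite inE => /orP[/eqP->|/ry].
Qed.

Lemma near_seq_gt r x (a : T -> R) : (forall h, h \in r -> h x < a h) ->
  \forall y \near x, forall h, h \in r -> h y < a h.
Proof.
elim: r => [|h r IH] ax; first by apply: nearW.
have hx : \forall y \near x, h y < a h.
  apply: (@cts_fun _ _ h x [set z | z < a h]); apply: open_nbhs_nbhs.
  by split; [exact: open_lt|exact: ax (mem_head _ _)].
have {IH}rx := IH (fun h' h'r => ax h' (mem_behead (s := h :: r) h'r)).
by apply: filterS2 hx rx => y hy ry h'; rewrite inE => /orP[/eqP->|/ry].
Qed.

Lemma rho_lsc x C e : e < rho x C -> \forall y \near x, e < rho y C.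
Proof.
move=> erho; have [e0|e0] := ltP e 0.
  by apply: nearW => y; exact: lt_le_trans (rho_ge0 _ _).
have [ev vrho] := midf_lt erho; set v := (e + rho x C) / 2 in ev vrho.
have v0 : 0 < v by exact: le_lt_trans ev.
have [v1 [r [ar mr vr]]] := rho_gt v0 vrho.
have [ew wv] := midf_lt ev; set w := (e + v) / 2 in ew wv.
have w0 : 0 < w by exact: le_lt_trans ew.
have := @near_seq_lt r x (fun=> w) (fun h hr => lt_le_trans wv (vr h hr)).
apply: filterS => y ry; apply: lt_le_trans ew _.
apply: rho_ge => //; first exact: le_trans (ltW wv) v1.
exists r; split=> //; first exact: approximableS (truncn_inv_le w0 (ltW wv)) ar.
by move=> h /ry/ltW.
Qed.

(** Common form of upper semicontinuity and K4: a lower bound e which rho reaches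
    along the whole chain, at points that no finite list of functions separates
    from x, survives in the limit. *)
Lemma rho_limit (I : Type) (i0 : I) (D : I -> set X) x v e :
    (forall i, regclosed (D i)) -> (forall i j, D i `<=` D j \/ D j `<=` D i) ->
    0 <= v -> v < e ->
    (forall (L : seq T) (d : R), 0 < d -> forall i, exists2 y,
      forall h, h \in L -> h y <= h x + d & e <= rho y (D i)) ->
  v < rho x (closure (\bigcup_i D i)).
Proof.
move=> rD chain v0 ve H.
have [vw we] := midf_lt ve; set w := (v + e) / 2 in vw we.
have [wu ue] := midf_lt we; set u := (w + e) / 2 in wu ue.
have w0 : 0 < w by exact: le_lt_trans vw.
have u0 : 0 < u by exact: lt_trans wu.
have uw : 0 < u - w by rewrite subr_gt0.
have u1 : u <= 1.
  have [y _ ey] := H [::] _ uw i0.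
  by case: (rho_gt u0 (lt_le_trans ue ey)).
have [|r [ar [h hr hD] wr]] :=
  @approximable_limit I i0 D x u (u - w) (Num.truncn u^-1) rD chain.
  move=> L i; have [y yL ey] := H L _ uw i.
  have [_ [r [ar mr ur]]] := rho_gt u0 (lt_le_trans ue ey).
  by exists i, y, r; split.
apply: lt_le_trans vw _; apply: rho_ge => //; first exact: le_trans (ltW wu) u1.
exists r; split.
- exact: approximableS (truncn_inv_le w0 (ltW wu)) ar.
- exists h => // -[z [hz /(_ (coz h))]]; rewrite setIC; apply/not_implyP.
  by split=> //; apply: open_nbhs_nbhs; split=> //; exact: open_coz.
- by move=> g /wr; rewrite subKr.
Qed.

(** Here the chain is constant. *)
Lemma rho_usc x C e : regclosed C -> rho x C < e -> \forall y \near x, rho y C < e.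
Proof.
move=> rC xe; apply: contrapT => nnear.
suff : rho x C < rho x (closure (\bigcup_(i in [set: unit]) C)).
  rewrite bigcup_const; last by exists tt.
  have /closure_id <- : closed C by rewrite -rC; exact: closed_closure.
  by rewrite ltxx.
apply: (@rho_limit unit tt (fun=> C) x _ e) => //; [by left|exact: rho_ge0|].
move=> L d d0 _; have Lx : \forall y \near x, forall h, h \in L -> h y < h x + d.
  by apply: near_seq_gt => h _; rewrite ltrDl.
apply: contrapT => noy; apply: nnear; apply: filterS Lx => y yL.
rewrite ltNge; apply/negP => ey; apply: noy; exists y => //.
by move=> h /yL/ltW.
Qed.

Lemma rho_continuous C : regclosed C -> continuous (rho^~ C).
Proof.
move=> rC x; apply/cvgrPdist_lt => e e0.
have A : \forall y \near x, rho x C - e < rho y C by apply: rho_lsc; rewrite gtrBl.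
have B : \forall y \near x, rho y C < rho x C + e by apply: rho_usc; rewrite ?ltrDl.
by apply: filterS2 A B => y A B; rewrite ltr_distlC A.
Qed.

Lemma rho_gt0_notin x C : 0 < rho x C -> ~ C x.
Proof.
move=> xC Cx; have h0 : 0 < rho x C / 2 by rewrite divr_gt0.
have [|_ [r [_ [h hr hC] /(_ h hr) hx]]] := rho_gt h0 (_ : _ < rho x C).
  by rewrite ltr_pdivrMr // mulr_natr mulr2n ltrDl.
by apply: hC; exists x; split=> //; exact: lt_le_trans hx.
Qed.

(** A good list which contains a bump off C and has a common point of positivity
    close to the given point witnesses that rho is positive there. *)
Lemma rho_gt0_dense C : closed C -> ~` C `<=` closure [set x | 0 < rho x C].
Proof.
move=> cC x nCx B /nbhs_interior Bx.
pose O := B° `&` ~` C.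
have oO : open O by apply: openI; [exact: open_interior|exact: closed_openC].
have [f fx fO] := @coz_basis R X O x crX oO (conj (nbhs_singleton Bx) nCx).
have [|s [gs fs sf]] := good_exists (f := f) (Vs := [:: coz f]).
  move=> V; rewrite inE => /eqP->; split=> //; split; last by exists x.
  exact: open_coz.
have [y [fy sy]] := sf _ (mem_head _ _).
exists y; split; last by apply: interior_subset; case: (fO _ fy).
pose n := maxn (size s) (\max_(g <- s) idx g).
have bs : bounded n s.
  split=> [|g gs']; first exact: leq_maxl.
  by apply: leq_trans (leq_maxr _ _); exact: leq_bigmax_seq.
have [v v0 vs] : exists2 v, 0 < v & forall h, h \in s -> v <= h y.
  elim: (s) sy => [|g s' IH] sy; first by exists 1.
  have [|v v0 vs] := IH; first by move=> h hs; apply: sy; rewrite inE hs orbT.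
  exists (Num.min v (g y)); first by rewrite lt_min v0; exact: sy (mem_head _ _).
  by move=> h; rewrite inE => /orP[/eqP->|/vs vh]; rewrite ge_min ?lexx ?vh ?orbT.
pose w := Num.min v n.+1%:R^-1.
have w0 : 0 < w by rewrite lt_min v0 invr_gt0 ltr0n.
have wn : w <= n.+1%:R^-1 by rewrite ge_min lexx orbT.
apply: (lt_le_trans w0); apply: rho_ge => //.
  by apply: le_trans wn _; rewrite invf_le1 ?ltr0n // ler1n.
exists s; split.
- apply: approximableS (good_approximable gs bs); rewrite truncn_ge_nat; last first.
    by rewrite invr_ge0 ltW.
  have nn : n%:R <= n.+1%:R :> R by rewrite ler_nat.
  apply: le_trans nn _.
  by rewrite -[leLHS]invrK lef_pV2 ?posrE ?invr_gt0 ?ltr0n.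
- by exists f => // -[z [fz Cz]]; case: (fO _ fz).
- by move=> h /vs; apply: le_trans; rewrite ge_min lexx.
Qed.

(** Here the points are all equal to x. *)
Lemma rho_chain (I : Type) (leI : rel I) (D : I -> set X) :
    inhabited I -> wochoice.well_order leI ->
    (forall i, regclosed (D i)) -> (forall i j, leI i j -> D i `<=` D j) ->
  forall x, rho x (closure (\bigcup_i D i)) = inf (range (fun i => rho x (D i))).
Proof.
move=> [i0] wo rD mono x.
have hlb : has_lbound (range (fun i => rho x (D i))).
  by exists 0 => _ [i _ <-]; exact: rho_ge0.
apply/eqP; rewrite eq_le; apply/andP; split.
  apply: lb_le_inf; first by exists (rho x (D i0)), i0.
  move=> _ [i _ <-]; apply: rho_le_sub => y Diy; apply: subset_closure.
  by exists i.
rewrite leNgt; apply/negP => lt.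
suff : rho x (closure (\bigcup_i D i)) < rho x (closure (\bigcup_i D i)) by rewrite ltxx.
apply: (rho_limit i0 rD _ _ lt) => [i j||L d d0 i].
- have [|m [[/asboolP[]-> mP] _]] := wo [pred z | `[< z = i \/ z = j >]].
  + by exists i; apply/asboolP; left.
  + by left; apply: mono; apply: mP; apply/asboolP; right.
  + by right; apply: mono; apply: mP; apply/asboolP; left.
- exact: rho_ge0.
- exists x; first by move=> h _; rewrite lerDl ltW.
  by apply: ge_inf => //; exists i.
Qed.

Lemma rho_quasi_kappa_metric : quasi_kappa_metric rho.
Proof.
split.
- by move=> x C _; exact: rho_ge0.
- move=> C rC; have cC : closed C by rewrite -rC; exact: closed_closure.
  exists [set x | 0 < rho x C]; split.
  + by rewrite openE => x /rho_lsc.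
  + by move=> x /rho_gt0_notin.
  + exact: rho_gt0_dense.
  + move=> x; split=> [x0 /=|/negP]; first by rewrite x0 ltxx.
    by rewrite -leNgt => x0; apply/eqP; rewrite eq_le x0 rho_ge0.
- by move=> C C' _ _ CC' x; exact: rho_le_sub.
- by move=> C; exact: rho_continuous.
- by move=> I leI D inhI wo rD mono x; exact: (rho_chain inhI wo).
Qed.

End KappaMetric.

Theorem corollary1p5 (R : realType) (X : topologicalType)
    (X_nonempty : [set: X] !=set0) (X_tychonoff : tychonoff_space X)
    (X_favorable : I_favorable X) :
  quasi_kappa_metrizable R X.
Proof.
have [_ crX] := X_tychonoff.
have [op opP] := favorable_skeletal R crX X_favorable.
have [prec [idx [wf _ fin pieces]]] := stratified_setT op.
exists (rho prec idx); apply: rho_quasi_kappa_metric => //.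
- by move=> g k; have [E EP] := fin g k Logic.I; exists E => f; exact: EP.
- move=> g; have [Ms MsP Mscov] := pieces g Logic.I; exists Ms => // M MMs.
  by have [clM Mg] := MsP M MMs; split=> //; exact: opP.
Qed.
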